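(* Let $n,k,m\ge 1$ be integers, let $\lambda$ be a real number in $(0,1/2)$, and let $$\tau_\lambda=\left\lceil\frac{1}{4^{h(\lambda)}-1}\right\rceil,\qquad C_{\lambda,k}=\sqrt[k]{\frac{4^{h(\lambda)\tau_\lambda}}{\tau_\lambda}}.$$ Then there exists a sequence $\Sigma=(a_1,\ldots,a_n)$ in $\mathbb{Z}^k$ that is $\left(C_{\lambda,k}\cdot m\cdot 4^{h(\lambda)n/k}\right)$-bounded and such that, for all distinct $A_1,A_2\in\mathcal{F}_{\lambda,n}$ of size at least $m$, $$e^m_\Sigma(A_1)\neq e^m_\Sigma(A_2).$$
   Context: Here $[1,n]=\{1,\ldots,n\}$, and $\mathcal{F}_{\lambda,n}$ is the family of all subsets of $[1,n]$ of size at most $\lambda n$. $h(\lambda)=-\lambda\log_2\lambda-(1-\lambda)\log_2(1-\lambda)$ is the binary entropy function. For a real number $M$, a sequence $(a_1,\ldots,a_n)$ in $\mathbb{Z}^k$ is $M$-bounded if $a_i\in[0,M]^k$ for every $i$. For $A\subseteq[1,n]$, $$e^m_{\Sigma}(A)=\sum_{\{i_1<\cdots<i_m\}\subseteq A}a_{i_1}\cdots a_{i_m}\in\mathbb{Z}^k,$$ where products of vectors are taken coordinatewise, with the convention $e^m_\Sigma(A)=0$ if $|A|<m$. *)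

(* Defs.v *)
From mathcomp Require Import all_boot all_order all_algebra.
From mathcomp Require Import all_classical reals exp.

Set Implicit Arguments.
Unset Strict Implicit.
Unset Printing Implicit Defensive.

Import Order.TTheory GRing.Theory Num.Theory.
Local Open Scope ring_scope.

Definition log2 (R : realType) (x : R) : R := ln x / ln 2.

Definition entropy (R : realType) (l : R) : R :=
  - l * log2 l - (1 - l) * log2 (1 - l).

Definition tau (R : realType) (l : R) : int :=
  Num.ceil (1 / (4 `^ entropy l - 1)).

(* For 0 < l < 1/2 the radicand is positive, so that its k-th root is its
   real power of exponent 1 / k. *)
Definition C_const (R : realType) (l : R) (k : nat) : R :=
  (4 `^ (entropy l * (tau l)%:~R) / (tau l)%:~R) `^ (k%:R^-1).

(* Here and below 'I_n = {0, ..., n-1} stands for the index set [1, n]. *)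
Definition small_sets (R : realType) (l : R) (n : nat) : {set {set 'I_n}} :=
  [set A : {set 'I_n} | #|A|%:R <= l * n%:R].

Definition bounded_seq (R : realType) (M : R) (n k : nat)
    (a : 'I_n -> 'rV[int]_k) : Prop :=
  forall (i : 'I_n) (j : 'I_k), 0 <= ((a i 0 j)%:~R : R) <= M.

(* The m-subsets of A encode the increasing m-tuples i_1 < ... < i_m in A;
   the sum is empty, hence 0, when #|A| < m. *)
Definition esum_sym (n k m : nat) (a : 'I_n -> 'rV[int]_k) (A : {set 'I_n}) :
    'rV[int]_k :=
  \row_j \sum_(I : {set 'I_n} | (I \subset A) && (#|I| == m))
            \prod_(i in I) a i 0 j.

(* Main.v *)
Require Import Defs.
From mathcomp Require Import all_boot all_order all_algebra.
From mathcomp Require Import all_classical reals exp.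
From mathcomp Require Import ring lra.
Import Order.TTheory GRing.Theory Num.Theory.
Local Open Scope ring_scope.

(** The alteration method. Put H = 4^h(lambda) and draw n + tau vectors at random
    with entries in {0, ..., q}. Two distinct sets of size at least m collide in
    one coordinate with probability at most m / (q + 1): if t lies in A1 but not
    in A2, the equation is affine in a_t with leading coefficient
    e^(m-1)(A1 \ t), and this coefficient vanishes only if one of m - 1 given
    entries does. At most H^(n + tau) ordered pairs are at stake, so for
    q + 1 > C m H^(n / k) the expected number of pairs colliding in all k
    coordinates is at most tau. Deleting one index from each bad pair leaves at
    least n indices and no bad pair. *)

(** * Elementary symmetric sums in one coordinate *)

(** The index type is arbitrary because sets of surviving indices are later mapped into a larger
    index set. *)
Definition elem_sym {T : finType} (m : nat) (x : T -> int) (A : {set T}) : int :=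
  \sum_(I : {set T} | (I \subset A) && (#|I| == m)) \prod_(i in I) x i.

Lemma elem_sym_imset (S T : finType) (f : S -> T) (m : nat) (x : T -> int)
    (A : {set S}) :
  injective f -> elem_sym m (fun i => x (f i)) A = elem_sym m x (f @: A).
Proof.
move=> finj; rewrite /elem_sym.
rewrite [RHS](reindex_onto (fun I : {set S} => f @: I)
    (fun J : {set T} => f @^-1: J)) /=; last first.
  move=> J /andP[/fintype.subsetP JA _]; apply/setP => y.
  apply/imsetP/idP => [[x0 + ->]|yJ]; first by rewrite inE.
  by have /imsetP[x0 _ yx] := JA _ yJ; exists x0; rewrite // inE -yx.
apply: eq_big => [I|I _].
  have fK : f @^-1: (f @: I) = I.
    by apply/setP => i; rewrite inE mem_imset.
  rewrite fK eqxx andbT card_imset //; congr (_ && _).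
  apply/fintype.subsetP/fintype.subsetP => [IA y|IA i iI].
    by case/imsetP => i iI ->; rewrite mem_imset // IA.
  by rewrite -(mem_imset _ _ finj) IA // mem_imset.
by rewrite big_imset //= => i j _ _; apply: finj.
Qed.

Lemma elem_sym_recl (T : finType) (m : nat) (x : T -> int) (A : {set T}) (t : T) :
  t \in A ->
  elem_sym m.+1 x A = x t * elem_sym m x (A :\ t) + elem_sym m.+1 x (A :\ t).
Proof.
move=> tA; rewrite /elem_sym (bigID (fun I : {set T} => t \in I)) /=.
congr (_ + _); last first.
  by apply: eq_bigl => I; rewrite finset.subsetD1 -!andbA; congr (_ && _); rewrite andbC.
rewrite big_distrr /= (reindex_onto (fun I : {set T} => t |: I)
    (fun J : {set T} => J :\ t)) /=; last first.
  by move=> J /andP[_ tJ]; rewrite finset.setD1K.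
apply: eq_big => [I|I /andP[_ /eqP tI]].
  rewrite finset.setU11 andbT finset.subUset finset.sub1set tA /= finset.subsetD1.
  (* If t lies in I, removing t from [t |: I] cannot give I back, so such I are excluded on both
     sides. *)
  have [tI|tI] := boolP (t \in I); last by rewrite finset.setU1K // eqxx !andbT cardsU1 tI.
  suff /negbTE-> : (t |: I) :\ t != I by rewrite !andbF.
  by apply/eqP => /setP/(_ t); rewrite !inE eqxx tI.
by rewrite big_setU1 // -tI !inE eqxx.
Qed.

(** The terms are nonnegative, so each of them vanishes, in particular the product over B itself. *)
Lemma elem_sym_eq0 (T : finType) (x : T -> int) (A B : {set T}) :
  (forall i, 0 <= x i) -> B \subset A -> elem_sym #|B| x A = 0 ->
  exists2 i, i \in B & x i = 0.
Proof.
move=> x0 BA e0.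
have /eqP : \prod_(i in B) x i = 0.
  by apply: (psumr_eq0P _ e0) => [I _|]; rewrite ?BA ?eqxx // prodr_ge0.
by case/prodf_eq0 => i iB /eqP; exists i.
Qed.

(** * Collisions of one pair of sets in one coordinate *)

(** An event in which the other entries determine the entry at t has probability at most 1 / [#|U|];
    denominators are cleared to stay in [nat]. *)
Lemma card_ffun_determined (T U : finType) (t : T) (S : {set {ffun T -> U}}) :
  (forall x y, x \in S -> y \in S -> (forall i, i != t -> x i = y i) -> x = y) ->
  (#|S| * #|U| <= #|U| ^ #|T|)%N.
Proof.
move=> Sdet; rewrite -card_ffun -(cardsT U) -cardsX.
(* Overwriting the value at t is injective on S * U. *)
pose g (p : {ffun T -> U} * U) : {ffun T -> U} :=
  [ffun i => if i == t then p.2 else p.1 i].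
rewrite -(card_in_imset (f := g)) ?max_card //.
move=> [x u] [y v]; rewrite !finset.in_setX /= => /andP[xS _] /andP[yS _] /ffunP gE.
have -> : u = v by have := gE t; rewrite !ffunE eqxx.
by congr (_, _); apply: Sdet => // i /negbTE it; have := gE i; rewrite !ffunE it.
Qed.

Lemma leq_card_bigcup (I T : finType) (B : {set I}) (Z : I -> {set T}) :
  (#|\bigcup_(i in B) Z i| <= \sum_(i in B) #|Z i|)%N.
Proof.
elim/big_rec2: _ => [|i n U _ leUn]; first by rewrite cards0.
by rewrite (leq_trans (leq_card_setU _ _)) ?leq_add2l.
Qed.

Definition intval {T : finType} {q : nat} (x : {ffun T -> 'I_q.+1}) (i : T) : int :=
  (x i : nat)%:Z.

Definition collisions {T : finType} (q m : nat) (A1 A2 : {set T}) :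
    {set {ffun T -> 'I_q.+1}} :=
  [set x | elem_sym m (intval x) A1 == elem_sym m (intval x) A2].

Lemma collisionsC (T : finType) (q m : nat) (A1 A2 : {set T}) :
  collisions q m A1 A2 = collisions q m A2 A1.
Proof. by apply/setP => x; rewrite !inE eq_sym. Qed.

(** Union bound over m + 1 events: a zero at one of m fixed entries ([Z i]), or a solution of the
    affine equation with nonzero leading coefficient ([L]). *)
Lemma card_collisions_notin (T : finType) (q m : nat) (A1 A2 : {set T}) (t : T) :
  (m < #|A1|)%N -> t \in A1 -> t \notin A2 ->
  (#|collisions q m.+1 A1 A2| * q.+1 <= m.+1 * q.+1 ^ #|T|)%N.
Proof.
move=> mA1 tA1 tA2.
have [B BA1 cB] : exists2 B : {set T}, B \subset A1 :\ t & #|B| = m.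
  have mA : (m <= #|A1 :\ t|)%N by rewrite -ltnS (leq_trans mA1) // (cardsD1 t A1) tA1.
  have : (0 < #|[set B : {set T} | B \subset A1 :\ t & #|B| == m]|)%N.
    by rewrite cards_draws bin_gt0.
  by case/card_gt0P => B; rewrite inE => /andP[BA /eqP cB]; exists B.
pose Z i := [set x : {ffun T -> 'I_q.+1} | x i == ord0].
pose L := [set x in collisions q m.+1 A1 A2 | elem_sym m (intval x) (A1 :\ t) != 0].
have cZ i : (#|Z i| * q.+1 <= q.+1 ^ #|T|)%N.
  have := @card_ffun_determined _ _ i (Z i); rewrite card_ord; apply => x y.
  rewrite !inE => /eqP xi /eqP yi xy; apply/ffunP => j.
  by have [->|/xy//] := eqVneq j i; rewrite xi yi.
have cL : (#|L| * q.+1 <= q.+1 ^ #|T|)%N.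
  have := @card_ffun_determined _ _ t L; rewrite card_ord; apply => x y.
  rewrite !inE !(@elem_sym_recl _ _ _ _ _ tA1) => /andP[/eqP Ex nx] /andP[/eqP Ey _] xy.
  have eq_esym k (A : {set T}) : t \notin A ->
      elem_sym k (intval y) A = elem_sym k (intval x) A.
    move=> tA; apply: eq_bigr => I /andP[/fintype.subsetP IA _].
    apply: eq_bigr => i iI; rewrite /intval xy //.
    by apply: contraNneq tA => <-; apply: IA.
  (* The sums over A2 and over [A1 :\ t] agree for x and y, so the nonzero coefficient can be
     cancelled. *)
  move: Ey; rewrite !eq_esym ?inE ?eqxx // -Ex => /addIr/(mulIf nx) Et.
  apply/ffunP => j; have [->|/xy//] := eqVneq j t.
  by apply/val_inj; move: Et; rewrite /intval => -[].
have sub : collisions q m.+1 A1 A2 \subset L :|: \bigcup_(i in B) Z i.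
  apply/fintype.subsetP => x xc; rewrite inE inE xc /=.
  case: eqP => //=; rewrite -cB => e0.
  have [i iB xi] : exists2 i, i \in B & intval x i = 0 by apply: elem_sym_eq0 e0.
  by apply/bigcupP; exists i => //; rewrite inE; apply/eqP/val_inj; case: xi.
have cU : (#|collisions q m.+1 A1 A2| <= #|L| + \sum_(i in B) #|Z i|)%N.
  apply: leq_trans (subset_leq_card sub) _.
  by rewrite (leq_trans (leq_card_setU _ _)) // leq_add2l leq_card_bigcup.
rewrite (leq_trans (leq_mul cU (leqnn _))) // mulnDl mulSn leq_add // -cB.
by rewrite big_distrl /= -sum_nat_const; exact: leq_sum.
Qed.

Lemma card_collisions (T : finType) (q m : nat) (A1 A2 : {set T}) :
  (0 < m)%N -> (m <= #|A1|)%N -> (m <= #|A2|)%N -> A1 != A2 ->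
  (#|collisions q m A1 A2| * q.+1 <= m * q.+1 ^ #|T|)%N.
Proof.
case: m => // m _ mA1 mA2; rewrite finset.eqEsubset negb_and.
case/orP => /subsetPn[t tA tNA]; first exact: (@card_collisions_notin _ _ _ _ _ t).
by rewrite collisionsC; exact: (@card_collisions_notin _ _ _ _ _ t).
Qed.

(** * First moment over all k coordinates *)

Definition bad_pairs {T : finType} {k q : nat} (m : nat) (F : {set {set T}})
    (x : {ffun 'I_k -> {ffun T -> 'I_q.+1}}) : {set {set T} * {set T}} :=
  [set p in finset.setX F F | (p.1 != p.2) &&
    [forall j, x j \in collisions q m p.1 p.2]].

(** Double counting of the (x, p) with p bad for x: at least t + 1 bad pairs for every x would
    exceed the total found by summing over p first. *)
Lemma exists_few_bad_pairs (T : finType) (k q m t : nat) (F : {set {set T}}) :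
  (0 < k)%N -> (0 < m)%N -> {in F, forall A : {set T}, (m <= #|A|)%N} ->
  (#|F| ^ 2 * m ^ k <= t * q.+1 ^ k)%N ->
  exists x : {ffun 'I_k -> {ffun T -> 'I_q.+1}}, (#|bad_pairs m F x| <= t)%N.
Proof.
move=> k0 m0 Fm Ft.
pose X := {ffun 'I_k -> {ffun T -> 'I_q.+1}}.
have [/existsP//|] := boolP [exists x : X, (#|bad_pairs m F x| <= t)%N].
rewrite negb_exists => /forallP many; exfalso.
have lower : (t.+1 * (q.+1 ^ #|T|) ^ k <= \sum_(x : X) #|bad_pairs m F x|)%N.
  have -> : (t.+1 * (q.+1 ^ #|T|) ^ k = \sum_(x : X) t.+1)%N.
    by rewrite sum_nat_const card_ffun card_ffun !card_ord mulnC.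
  by apply: leq_sum => x _; rewrite ltnNge many.
have upper : ((\sum_(x : X) #|bad_pairs m F x|) * q.+1 ^ k <=
              #|F| ^ 2 * (m ^ k * (q.+1 ^ #|T|) ^ k))%N.
  under eq_bigr => x _ do rewrite -sum1_card.
  rewrite big_distrl /=; under eq_bigr => x _ do rewrite big_distrl /=.
  rewrite (exchange_big_dep [pred p | p \in finset.setX F F & p.1 != p.2]) /=; last first.
    by move=> x p _; rewrite !inE => /and3P[-> ->].
  apply: (@leq_trans (\sum_(p in finset.setX F F) (m ^ k * (q.+1 ^ #|T|) ^ k))); last first.
    by rewrite sum_nat_const cardsX mulnn.
  (* Diagonal pairs are never bad; their share of the bound is discarded. *)
  rewrite [leqRHS](bigID (fun p => p.1 != p.2)) /= -[leqLHS]addn0 leq_add //.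
  apply: leq_sum => -[A1 A2] /=; rewrite finset.in_setX => /andP[/andP[A1F A2F] neqA].
  rewrite -big_distrl /= -expnMn.
  (* The k coordinates are chosen independently, so the count is a k-th power. *)
  have -> : (\sum_(x : X | (A1, A2) \in bad_pairs m F x) 1 =
             #|collisions q m A1 A2| ^ k)%N.
    rewrite sum1_card -[k in RHS]card_ord -card_ffun_on; apply: eq_card => x.
    rewrite [LHS](_ : _ = ((A1, A2) \in bad_pairs m F x)) //.
    rewrite finset.in_set finset.in_setX A1F A2F neqA /=.
    by apply/forallP/ffun_onP => xj j; have := xj j.
  by rewrite -expnMn leq_exp2r ?card_collisions ?Fm.
have : (t.+1 * (q.+1 ^ #|T|) ^ k * q.+1 ^ k <= t * q.+1 ^ k * (q.+1 ^ #|T|) ^ k)%N.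
  apply: leq_trans (leq_mul lower (leqnn _)) _; apply: leq_trans upper _.
  by rewrite mulnA leq_mul2r Ft orbT.
by rewrite mulnAC -!mulnA leq_pmul2r ?ltnn // muln_gt0 !expn_gt0.
Qed.

(** * Entropy bound and constants *)

Lemma card_small_sets_sqr_le (R : realType) (l : R) (n : nat) :
  0 < l -> l < 1 / 2 ->
  (#|small_sets l n|%:R : R) ^+ 2 <= 4 `^ (entropy l * n%:R).
Proof.
move=> l0 l12; have l1 : 0 < 1 - l by lra.
pose u := ln l; pose v := ln (1 - l).
have uv : u <= v by rewrite ler_ln ?posrE //; lra.
have lE : l = sequences.expR u by rewrite lnK ?posrE.
have l1E : 1 - l = sequences.expR v by rewrite lnK ?posrE.
(* E bounds from below the weight l^|A| (1 - l)^(n - |A|) of a small set A;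
   all the weights add up to 1. *)
pose E := sequences.expR (n%:R * (l * u + (1 - l) * v)).
have E0 : 0 < E by rewrite expR_gt0.
have NE : #|small_sets l n|%:R * E <= 1.
  (* The total weight is the expansion of (l + (1 - l))^n over subsets. *)
  rewrite [leRHS](_ : 1 = \sum_(A : {set 'I_n}) \prod_i (if i \in A then l else 1 - l)); last first.
    by rewrite -bigA_distr /= big1 // => i _; rewrite addrC subrK.
  rewrite mulr_natl -sumr_const.
  rewrite [leRHS](bigID (fun A => A \in small_sets l n)) /= -[leLHS]addr0.
  rewrite lerD //; last first.
    by apply: sumr_ge0 => A _; apply: prodr_ge0 => i _; case: ifP => _; apply: ltW.
  apply: ler_sum => A; rewrite inE => Al.
  rewrite (bigID (fun i => i \in A)) /=.
  rewrite (eq_bigr (fun=> l)); last by move=> i ->.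
  rewrite [X in _ * X](eq_bigr (fun=> 1 - l)); last by move=> i /negbTE->.
  rewrite !prodr_const l1E lE -!expRM_natl -expRD ler_expR.
  have -> : #|[pred i | i \notin A]|%:R = n%:R - #|A|%:R :> R.
    apply/esym/eqP; rewrite subr_eq -natrD addnC; apply/eqP; congr _%:R.
    exact: esym (etrans (cardC A) (card_ord n)).
  (* As u <= v, the exponent |A| u + (n - |A|) v does not increase with |A|, so |A| <= l n gives the
     bound. *)
  nra.
have ln2 : ln (2 : R) != 0 by rewrite gt_eqF // ln_gt0 // ltr1n.
have ln4 : ln (4 : R) = 2 * ln 2.
  by rewrite (_ : 4 = 2 ^+ 2) ?lnXn // ?mulr_natl //; ring.
have -> : 4 `^ (entropy l * n%:R) = E^-1 ^+ 2 :> R.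
  rewrite /powR pnatr_eq0 /= -expRN -expRM_natl ln4; congr (sequences.expR _).
  by rewrite /entropy /log2 -/u -/v; field.
rewrite ler_pXn2r ?nnegrE ?ler0n ?invr_ge0 ?(ltW E0) //.
by rewrite -[leRHS]mul1r ler_pdivlMr.
Qed.

Lemma entropy_gt0 (R : realType) (l : R) : 0 < l -> l < 1 / 2 -> 0 < entropy l.
Proof.
move=> l0 l1.
have ln2 : 0 < ln (2 : R) by rewrite ln_gt0 // ltr1n.
have ul : log2 l < 0 by rewrite /log2 pmulr_llt0 ?invr_gt0 // ln_lt0 // l0; lra.
have vl : log2 (1 - l) < 0.
  by rewrite /log2 pmulr_llt0 ?invr_gt0 // ln_lt0 //; apply/andP; split; lra.
by rewrite /entropy; nra.
Qed.

(** Positive entropy gives 4^h > 1. Positivity lets [tau] serve as a number of spare indices. *)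
Lemma tau_gt0 (R : realType) (l : R) : 0 < l -> l < 1 / 2 -> 0 < tau l.
Proof.
move=> l0 l1; rewrite /tau ceil_gt0 divr_gt0 // subr_gt0.
rewrite -[ltLHS](powRr0 4) /powR !pnatr_eq0 /= ltr_expR mul0r.
by rewrite mulr_gt0 ?entropy_gt0 // ln_gt0 // ltr1n.
Qed.

(** The k-th power removes the roots, and t cancels the division by [tau] in [C_const]. The result
    is the entropy bound on ordered pairs over n + t indices, times m^k. *)
Lemma radius_powk (R : realType) (l : R) (n k m t : nat) :
  (0 < k)%N -> (0 < t)%N -> tau l = t%:Z ->
  (C_const l k * m%:R * 4 `^ (entropy l * n%:R / k%:R)) ^+ k * t%:R =
  4 `^ (entropy l * (n + t)%:R) * m%:R ^+ k.
Proof.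
move=> k0 t0 tE; have kn0 : k%:R != 0 :> R by rewrite pnatr_eq0 -lt0n.
have rootK (x y : R) : 0 < x -> (x `^ (y / k%:R)) ^+ k = x `^ y.
  by move=> x0; rewrite -powR_mulrn ?powR_ge0 // -powRrM divfK.
rewrite !exprMn rootK // /C_const tE -[k%:R^-1]mul1r rootK; last first.
  by rewrite divr_gt0 ?powR_gt0 // ltr0n.
rewrite powRr1 ?divr_ge0 ?powR_ge0 // natrD mulrDr powRD ?pnatr_eq0 ?implybT //.
by field; rewrite pnatr_eq0 -lt0n.
Qed.

(** * Deletion of one index per bad pair *)

Theorem theorem4p2 (R : realType) (n k m : nat) (lambda : R)
    (hn : (1 <= n)%N) (hk : (1 <= k)%N) (hm : (1 <= m)%N)
    (hlambda0 : 0 < lambda) (hlambda1 : lambda < 1 / 2) :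
  exists a : 'I_n -> 'rV[int]_k,
    bounded_seq
      (C_const lambda k * m%:R * 4 `^ (entropy lambda * n%:R / k%:R)) a /\
    (forall A1 A2 : {set 'I_n},
       A1 \in small_sets lambda n -> A2 \in small_sets lambda n ->
       (m <= #|A1|)%N -> (m <= #|A2|)%N -> A1 <> A2 ->
       esum_sym m a A1 <> esum_sym m a A2).
Proof.
have [t t0 tE] : exists2 t : nat, (0 < t)%N & tau lambda = t%:Z.
  have := tau_gt0 _ _ hlambda0 hlambda1; case: (tau lambda) => // t t0.
  by exists t.
have := radius_powk R lambda n k m t hk t0 tE.
set x := _ * 4 `^ _ => xk.
have x0 : 0 <= x by rewrite !mulr_ge0 ?powR_ge0.
(* Rounding down keeps the entries at most x, while q + 1 > x yields the first-moment condition
   [Ft]. *)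
pose q := Num.truncn x; have /andP[qx xq] := truncn_itv x0.
pose F := [set A in small_sets lambda (n + t) | (m <= #|A|)%N].
have FS : (#|F| <= #|small_sets lambda (n + t)|)%N.
  by apply: subset_leq_card; apply/fintype.subsetP => A; rewrite inE => /andP[].
have Ft : (#|F| ^ 2 * m ^ k <= t * q.+1 ^ k)%N.
  rewrite -(ler_nat R) !natrM !natrX.
  apply: (@le_trans _ _ (x ^+ k * t%:R)).
    rewrite xk ler_wpM2r ?exprn_ge0 //.
    apply: le_trans (card_small_sets_sqr_le R lambda (n + t) hlambda0 hlambda1).
    by rewrite -expr2 ler_pXn2r ?nnegrE ?ler0n // ler_nat.
  by rewrite mulrC ler_wpM2l // ler_pXn2r ?nnegrE ?ler0n // ltW.
have [y yt] : exists y : {ffun 'I_k -> {ffun 'I_(n + t) -> 'I_q.+1}},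
    (#|bad_pairs m F y| <= t)%N.
  by apply: exists_few_bad_pairs => // A; rewrite inE => /andP[].
have i0 : 'I_(n + t) by exists 0%N; rewrite addn_gt0 hn.
(* The index to delete is taken from the first set. The default [i0] is never reached on bad pairs,
   whose sets have at least m >= 1 elements. *)
pose g (p : {set 'I_(n + t)} * {set 'I_(n + t)}) := odflt i0 [pick i in p.1].
pose D := [set g p | p in bad_pairs m F y].
have nD : (n <= #|~: D|)%N.
  rewrite -(leq_add2l #|D|) cardsC card_ord addnC leq_add2l.
  exact: leq_trans (leq_imset_card _ _) yt.
(* The new sequence is carried by n of the surviving indices. *)
pose f (i : 'I_n) := enum_val (widen_ord nD i).
have fD i : f i \notin D by rewrite -finset.in_setC enum_valP.
have finj : injective f by move=> i j /enum_val_inj/(congr1 val)/= /val_inj.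
exists (fun i => \row_j (y j (f i) : nat)%:Z); split=> [i j|].
  rewrite mxE -[(_ : int)%:~R]/((y j (f i) : nat)%:R) ler0n /=.
  by apply: le_trans qx; rewrite ler_nat -ltnS.
move=> A1 A2 A1s A2s mA1 mA2 A12 /rowP eqA.
have small (A : {set 'I_n}) : A \in small_sets lambda n -> (m <= #|A|)%N -> f @: A \in F.
  rewrite !inE card_imset // => Al ->; rewrite andbT (le_trans Al) //.
  by rewrite ler_pM2l // ler_nat leq_addr.
have bad : (f @: A1, f @: A2) \in bad_pairs m F y.
  rewrite finset.in_set finset.in_setX !small //=; apply/andP; split.
    by apply/eqP => /(imset_inj finj).
  apply/forallP => j; rewrite inE -!elem_sym_imset //; apply/eqP.
  transitivity (esum_sym m (fun i => \row_j (y j (f i) : nat)%:Z) A1 0 j).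
    by rewrite mxE; apply: eq_bigr => I _; apply: eq_bigr => i _; rewrite mxE.
  by rewrite eqA mxE; apply: eq_bigr => I _; apply: eq_bigr => i _; rewrite mxE.
(* The index deleted for this pair would lie in the image of [f], which avoids [D]. *)
have : g (f @: A1, f @: A2) \in D by apply: imset_f.
have : g (f @: A1, f @: A2) \in f @: A1.
  rewrite /g /=; case: pickP => //= none.
  have /card_gt0P[i iA] := leq_trans hm mA1.
  by have := none (f i); rewrite imset_f.
by case/imsetP => i _ ->; apply/negP.
Qed.
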